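(* Let $A,M$ be integer $r\times r$ matrices with $A^t=-A$, let $N=-M^t$, and suppose that $A-N$ and $M-N$ are invertible (over $\mathbb Q$). Let $H$ be the $nr\times nr$ block matrix built from $A,M,N$ as in the context, and set $X=(A-N)^{-1}(A-M)$ and $F=(M-NX^n)(\mathbb I-X)^{-1}$. If $H$ is invertible, the $r\times r$ blocks of its inverse are $$H^{-1}_{\alpha\beta}=\begin{cases}(\mathbb I-X^{n-\alpha}F^{-1}NX^{\alpha-1})(A-N)^{-1}&\text{if }\alpha=\beta,\\ (-X^{n-\alpha}F^{-1}NX^{\beta-1})(A-N)^{-1}&\text{if }\alpha>\beta,\\ -(H^{-1}_{\beta\alpha})^t&\text{if }\alpha<\beta,\end{cases}$$ where $^t$ is transposition of the block. In particular: (1) for $H=H_D$ with $n=r$ (when $H_D$ is invertible), $$(H_D^{-1})_{\alpha\beta}=\begin{cases}-(\mathbb I+X_r^n(\mathbb I+X_r)^{-1})N_r^{-1}&\text{if }\alpha=\beta,\\ -X_r^{\beta-\alpha-1}(\mathbb I+X_r)^{-1}N_r^{-1}&\text{if }\alpha>\beta,\\ -X_r^{\beta-\alpha+1}(\mathbb I+X_r)^{-1}N_r^{-1}=-((H_D^{-1})_{\beta\alpha})^t&\text{if }\alpha<\beta;\end{cases}$$ (2) for $H=H_S$ with $n=r+1$, $$(H_S^{-1})_{\alpha\beta}=\begin{cases}0&\text{if }\alpha=\beta,\\ \tfrac12(S_r^{\beta-\alpha+1}-S_r^{\beta-\alpha})&\text{if }\alpha>\beta,\\ \tfrac12(S_r^{\beta-\alpha}-S_r^{\beta-\alpha-1})=-((H_S^{-1})_{\beta\alpha})^t&\text{if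 }\alpha<\beta.\end{cases}$$
   Context: $n,r$ are positive integers, $\alpha,\beta\in\{1,\dots,n\}$. For $A,M,N$ as in the claim, $H$ denotes the $nr\times nr$ matrix of $n\times n$ blocks $H_{\alpha\beta}$ of size $r\times r$ with $H_{\alpha\alpha}=A$, $H_{\alpha\beta}=M$ for $\alpha<\beta$, $H_{\alpha\beta}=N$ for $\alpha>\beta$. $\mathbb I$ is the identity matrix. $N_r$ is the $r\times r$ matrix with all entries on and above the diagonal $-1$ and zeros below; $M_r=-N_r^t$; $X_r=N_r^{-1}M_r$ (equivalently: superdiagonal entries $1$, all entries of the last row $-1$ and all other entries $0$). $S_r=\sum_{i=1}^{r-1}E_{i,i+1}-E_{r,1}$, where $E_{ij}$ are the $r\times r$ matrix units. $H_D$ is $H$ for $A=0$, $M=M_r$ (so $N=N_r$). $H_S$ is $H$ for $A=-(M_r+N_r)$, $M=\mathbb I$ (so $N=-\mathbb I$). *)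

(* Defs.v *)
From HB Require Import structures.
From mathcomp Require Import all_boot all_order all_algebra.

Set Implicit Arguments.
Unset Strict Implicit.
Unset Printing Implicit Defensive.

Import GRing.Theory.
Local Open Scope ring_scope.

(* Blocks and special matrices have size r.+1, a positive size, so that
   'M[rat]_r.+1 is a unit ring: there * is matrix multiplication, and
   B ^ z (z : int) is the integer power of an invertible matrix B.
   Block indices are 0-based: a : 'I_n stands for the index a.+1 of {1..n}. *)

Definition ratmx (r : nat) (A : 'M[int]_r) : 'M[rat]_r := map_mx intr A.

Definition blockH (n r : nat) (A M N : 'M[rat]_r) : 'M[rat]_(\sum_(i < n) r) :=
  \mxblock_(i < n, j < n) (if i == j then A else if (i < j)%N then M else N).

Definition blk (n r : nat) (B : 'M[rat]_(\sum_(i < n) r)) (a b : 'I_n) :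
    'M[rat]_r :=
  submxblock (p_ := fun=> r) (q_ := fun=> r) B a b.

Definition Xmx (r : nat) (A M N : 'M[rat]_r.+1) : 'M[rat]_r.+1 :=
  (A - N)^-1 * (A - M).

Definition Fmx (n r : nat) (A M N : 'M[rat]_r.+1) : 'M[rat]_r.+1 :=
  let X := Xmx A M N in (M - N * X ^+ n) * (1 - X)^-1.

Definition Nr (r : nat) : 'M[rat]_r.+1 :=
  \matrix_(i, j) (if (i <= j)%N then -1 else 0).

Definition Mr (r : nat) : 'M[rat]_r.+1 := - (Nr r)^T.

Definition Xr (r : nat) : 'M[rat]_r.+1 := (Nr r)^-1 * Mr r.

(* lift ord_max i and lift ord0 i are i and i.+1, viewed in 'I_r.+1. *)
Definition Sr (r : nat) : 'M[rat]_r.+1 :=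
  \sum_(i < r) delta_mx (lift ord_max i) (lift ord0 i) - delta_mx ord_max ord0.

Definition HD (n r : nat) : 'M[rat]_(\sum_(i < n) r.+1) :=
  blockH n 0 (Mr r) (Nr r).

Definition HS (n r : nat) : 'M[rat]_(\sum_(i < n) r.+1) :=
  blockH n (- (Mr r + Nr r)) 1 (- 1).

(* Main.v *)
(* Subtracting consecutive block rows of [H v = w] gives
   [(A - N) v_a - (A - M) v_(a+1) = w_a - w_(a+1)], i.e. a recursion of ratio
   [X], and the last row closes it with [F v_n = ...].  So a block column is
   sent by [H] to a prescribed one as soon as these equations hold.  The powers
   [X^(n-a)] are sent to the constant column [F], so [F] is invertible when [H]
   is; the columns of the claimed inverse are corrections of these powers by a
   telescoping term.  The special cases use [X_r^(r+1) = 1] and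
   [S_r^r = -1] (with [r] the block size), which reduce [F] to
   [- N_r X_r^-1 (1 + X_r)] for [H_D] and to [1] for [H_S]. *)

Require Import Defs.
From HB Require Import structures.
From mathcomp Require Import all_boot all_order all_algebra.
From mathcomp Require Import zify.

Set Implicit Arguments.
Unset Strict Implicit.
Unset Printing Implicit Defensive.

Import GRing.Theory.
Local Open Scope ring_scope.

(** * Block rows over a noncommutative unit ring *)

Definition block_entry (T : Type) (A M N : T) (a k : nat) : T :=
  if a == k then A else if (a < k)%N then M else N.

Section BlockSystem.
Variables (R : unitRingType) (A M N : R).
Local Notation h := (block_entry A M N).
Local Notation D := (A - N).

(** Rows [a] and [a.+1] agree outside columns [a] and [a.+1]: both carry [N] to the left of these
    and [M] to the right. *)
Lemma block_row_step (n a : nat) (v : nat -> R) : (a < n)%N ->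
  \sum_(k < n.+1) h a k * v k - \sum_(k < n.+1) h a.+1 k * v k
  = D * v a - (A - M) * v a.+1.
Proof.
move=> lt_an; rewrite -sumrB.
transitivity (\sum_(k < n.+1) ((if k == a :> nat then D * v k else 0)
                - (if k == a.+1 :> nat then (A - M) * v k else 0))).
  apply: eq_bigr => k _; rewrite -mulrBl /block_entry ![_ == nat_of_ord k]eq_sym.
  case: (ltngtP a k) => [lt_ak|lt_ka|<-].
  - rewrite sub0r ltn_neqAle lt_ak andbT eq_sym; case: eqP => [_|_] /=.
      by rewrite -mulNr opprB.
    by rewrite subrr mul0r oppr0.
  - by rewrite ltn_eqF ?(leq_trans lt_ka) // ltnNge ltnW ?(leq_trans lt_ka) //=
      !subrr mul0r.
  - by rewrite ltn_eqF // ltnNge leqnSn subr0.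
rewrite sumrB -!big_mkcond /=.
rewrite (big_ord1_eq +%R (fun k => D * v k)).
by rewrite (big_ord1_eq +%R (fun k => (A - M) * v k)) !ltnS lt_an ltnW.
Qed.

Lemma block_row_last (n : nat) (v : nat -> R) :
  \sum_(k < n.+1) h n k * v k = N * (\sum_(k < n.+1) v k) + D * v n.
Proof.
rewrite !big_ord_recr /= {2}/block_entry eqxx mulrDr mulr_sumr -addrA -mulrDl.
rewrite subrKC; congr (_ + _); apply: eq_bigr => k _.
by rewrite /block_entry gtn_eqF // ltnNge ltnW.
Qed.

(** Induction from the last row upwards: once row [a.+1] has the value [w a.+1], [block_row_step]
    fixes row [a]. *)
Lemma block_rowE (n : nat) (v w : nat -> R) :
    (forall a, (a < n)%N -> D * v a - (A - M) * v a.+1 = w a - w a.+1) ->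
    N * (\sum_(k < n.+1) v k) + D * v n = w n ->
  forall a, (a <= n)%N -> \sum_(k < n.+1) h a k * v k = w a.
Proof.
move=> step last a le_an; rewrite -(subKn le_an).
elim: (n - a)%N (leq_subr a n) => [|d IHd] le_dn.
  by rewrite subn0 block_row_last.
have lt_bn : (n - d.+1 < n)%N by rewrite ltn_subrL (leq_ltn_trans _ le_dn).
have := block_row_step v lt_bn; rewrite (step _ lt_bn) -subSn // subSS.
by rewrite IHd 1?ltnW // => /addIr.
Qed.

Hypotheses (uD : D \is a GRing.unit) (uMN : M - N \is a GRing.unit).
Let X := D^-1 * (A - M).

Lemma sub1XE : 1 - X = D^-1 * (M - N).
Proof.
rewrite /X -[X in X - _](mulVr uD) -mulrBr opprB [_ + (M - A)]addrC addrA.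
by rewrite subrK.
Qed.

Lemma unit_sub1X : 1 - X \is a GRing.unit.
Proof. by rewrite sub1XE unitrMr ?unitrV. Qed.

Lemma mulDX (y : R) : D * (X * y) = (A - M) * y.
Proof. by rewrite /X -!mulrA mulVKr. Qed.

Lemma block_row_pow (n a : nat) : (a <= n)%N ->
  \sum_(k < n.+1) h a k * X ^+ (n - k)
  = (M - N * X ^+ n.+1) * (1 - X)^-1.
Proof.
move: a; apply: (block_rowE (v := fun k => X ^+ (n - k))
          (w := fun=> (M - N * X ^+ n.+1) * (1 - X)^-1)).
  by move=> a lt_an; rewrite -mulDX -exprS -subSn // subSS !subrr.
apply: (canRL (mulrK unit_sub1X)).
rewrite subnn mulr1 (reindex_inj rev_ord_inj) /=.
under eq_bigr => i _ do rewrite subSS subKn -1?ltnS //.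
rewrite mulrDl {2}sub1XE mulVKr // -mulrA.
(* [R] is not commutative, but [1 - X] commutes with powers of [X], so the geometric sum also
   telescopes with the factor on the right. *)
have -> : (\sum_(i < n.+1) X ^+ i) * (1 - X) = 1 - X ^+ n.+1.
  have comX : GRing.comm (1 - X) (\sum_(i < n.+1) X ^+ i).
    apply: commr_sum => i _; apply: commrX; apply: commr_sym.
    by apply: commrB; [exact: commr1 | exact: commr_refl].
  by rewrite -comX -[1 - X]opprB mulNr -subrX1 opprB.
by rewrite mulrBr mulr1 addrC addrA subrK.
Qed.

(* [geom_step b k] is [X^(b-k) - X^(b-k-1)] for [k < b], and the Kronecker
   delta for [k >= b]; being a difference, it telescopes in [k]. *)
Definition geom (b k : nat) : R := if (k <= b)%N then X ^+ (b - k) else 0.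
Definition geom_step (b k : nat) : R := geom b k - geom b k.+1.

(** The truncated powers solve the recursion of ratio [X] with a single unit source at [b]. *)
Lemma geom_rec (b k : nat) : geom b k - X * geom b k.+1 = (k == b)%:R.
Proof.
rewrite /geom; case: (ltngtP k b) => [lt_kb|_|->].
- by rewrite -exprS -subSn // subSS subrr.
- by rewrite mulr0 subrr.
- by rewrite subnn mulr0 subr0.
Qed.

(** This difference of sources is the one that consecutive rows of column [b] of the identity
    require. *)
Lemma geom_step_rec (b k : nat) :
  geom_step b k - X * geom_step b k.+1 = (k == b)%:R - (k.+1 == b)%:R.
Proof. by rewrite -!geom_rec /geom_step mulrBr !opprD !opprK addrACA. Qed.

Lemma sum_geom_step (n b : nat) : (b <= n)%N ->
  \sum_(k < n.+1) geom_step b k = X ^+ b.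
Proof.
move=> le_bn; rewrite -(big_mkord xpredT (geom_step b)).
rewrite (telescope_sumr_eq (fun k => - geom b k)) //; last first.
  by move=> k _; rewrite opprK addrC.
by rewrite /geom leq0n subn0 ltnNge le_bn oppr0 sub0r opprK.
Qed.

(** The error [N * X ^+ b] is the same in every row [a], so a right multiple of the column of
    [block_row_pow] can cancel it. *)
Lemma block_row_geom (n a b : nat) : (b <= n)%N -> (a <= n)%N ->
  \sum_(k < n.+1) h a k * geom_step b k = D * (a == b)%:R + N * X ^+ b.
Proof.
move=> le_bn; move: a.
apply: (block_rowE (v := geom_step b)
          (w := fun a => D * (a == b)%:R + N * X ^+ b)).
  move=> a _; rewrite -mulDX -mulrBr geom_step_rec mulrBr.
  by rewrite opprD addrACA subrr addr0.
rewrite sum_geom_step // addrC -geom_rec /geom_step {2 4}/geom.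
by rewrite ltnNge le_bn mulr0.
Qed.

(* One formula for the block [(a, b)] of the inverse on both sides of the
   diagonal (indices run over [0..n]): the first term vanishes for [b < a]. *)
Definition block_inv_entry (n a b : nat) : R :=
  (geom_step b a
   - X ^+ (n - a) * ((M - N * X ^+ n.+1) * (1 - X)^-1)^-1 * N * X ^+ b) * D^-1.

Lemma block_row_inv (n a b : nat) :
    (M - N * X ^+ n.+1) * (1 - X)^-1 \is a GRing.unit ->
    (a <= n)%N -> (b <= n)%N ->
  \sum_(k < n.+1) h a k * block_inv_entry n k b = (a == b)%:R.
Proof.
rewrite /block_inv_entry; set F := _ * (1 - X)^-1 => uF le_an le_bn.
under eq_bigr => k _ do rewrite mulrA mulrBr !mulrA.
rewrite -mulr_suml sumrB block_row_geom // -!mulr_suml block_row_pow // -/F.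
by rewrite divrr // mul1r addrK mulr_natr mulrnAl divrr.
Qed.
End BlockSystem.

(** * Passage to block matrices over [rat] *)

Lemma blockHE (n r : nat) (A M N : 'M[rat]_r) :
  blockH n A M N = \mxblock_(i < n, j < n) block_entry A M N i j.
Proof. by []. Qed.

Lemma mul_blockH_inv (n r : nat) (A M N : 'M[rat]_r.+1) :
    A - N \in unitmx -> M - N \in unitmx -> Fmx n.+1 A M N \in unitmx ->
  blockH n.+1 A M N
    *m \mxblock_(i < n.+1, j < n.+1) block_inv_entry A M N n i j = 1%:M.
Proof.
move=> uD uMN uF; rewrite blockHE mul_mxblock -mxdiagZ /mxdiag.
apply: eq_mxblock => a b; rewrite conform_mx_id.
have := block_row_inv uD uMN uF (leq_ord a) (leq_ord b).
by rewrite -val_eqE => ->; case: eqP.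
Qed.

Lemma unit_Fmx (n r : nat) (A M N : 'M[rat]_r.+1) :
    A - N \in unitmx -> M - N \in unitmx -> blockH n.+1 A M N \in unitmx ->
  Fmx n.+1 A M N \in unitmx.
Proof.
move=> uD uMN uH; set X := Xmx A M N.
pose V := \mxblock_(k < n.+1, j < 1) (X ^+ (n - k)).
pose W := \mxblock_(k < n.+1, j < 1) Fmx n.+1 A M N.
have HV : blockH n.+1 A M N *m V = W.
  rewrite blockHE mul_mxblock; apply: eq_mxblock => a _.
  exact: block_row_pow uD uMN n a (leq_ord a).
(* The last block of [V] is [X ^+ 0]. Since [V] is the inverse of [H] times [W], that block is also
   the sum of the last block row of the inverse, times [F]; hence [F] has a left inverse. *)
have : submxblock V ord_max ord0 = 1 by rewrite mxblockK subnn.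
rewrite -(mulKmx uH V) HV -[invmx _]submxblockK mul_mxblock mxblockK.
by rewrite -mulmx_suml => /mulmx1_unit[].
Qed.

Lemma blk_invmx_blockH (n r : nat) (A M N : 'M[rat]_r.+1) (a b : 'I_n.+1) :
    A - N \in unitmx -> M - N \in unitmx -> blockH n.+1 A M N \in unitmx ->
  blk (invmx (blockH n.+1 A M N)) a b = block_inv_entry A M N n a b.
Proof.
move=> uD uMN uH; have uF := unit_Fmx uD uMN uH.
have := congr1 (mulmx (invmx (blockH n.+1 A M N))) (mul_blockH_inv uD uMN uF).
by rewrite mulKmx // mulmx1 => <-; rewrite /blk mxblockK.
Qed.

Lemma tr_blockH (n r : nat) (A M : 'M[rat]_r) : A^T = - A ->
  (blockH n A M (- M^T))^T = - blockH n A M (- M^T).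
Proof.
move=> skA; rewrite /blockH tr_mxblock -mxblockN; apply: eq_mxblock => a b.
rewrite eq_sym; case: (ltngtP a b) => [lt_ab|lt_ba|/val_inj->].
- by rewrite -val_eqE /= ltn_eqF // linearN /= trmxK.
- by rewrite -val_eqE /= gtn_eqF // opprK.
- by rewrite eqxx.
Qed.

Lemma tr_blk_invmx (n r : nat) (B : 'M[rat]_(\sum_(i < n) r)) (a b : 'I_n) :
  B^T = - B -> blk (invmx B) a b = - (blk (invmx B) b a)^T.
Proof.
move=> skB; rewrite /blk tr_submxblock trmx_inv skB -[- B]scaleN1r.
suff ->: invmx (-1 *: B) = - invmx B.
  by rewrite (submxblockN (p_ := fun=> r) (q_ := fun=> r)) opprK.
have [uB|nuB] := boolP (B \in unitmx).
  by rewrite invmxZ ?unitmxZ // invrN1 scaleN1r.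
(* By convention [invmx] fixes a singular matrix. *)
by rewrite !invmx_out ?inE ?unitmxZ // scaleN1r.
Qed.

Lemma geom_step_gt (R : unitRingType) (A M N : R) (b k : nat) : (b < k)%N ->
  geom_step A M N b k = 0.
Proof.
move=> lt_bk.
by rewrite /geom_step /geom ![(_ <= b)%N]leqNgt lt_bk leqW ?subrr.
Qed.

Lemma geom_step_eq (R : unitRingType) (A M N : R) (b : nat) :
  geom_step A M N b b = 1.
Proof. by rewrite /geom_step /geom leqnn ltnn subnn subr0. Qed.

Lemma geom_step_lt (R : unitRingType) (A M N : R) (b k : nat) :
    (k < b)%N ->
  geom_step A M N b k = ((A - N)^-1 * (A - M)) ^ (b%:Z - k%:Z)
                        - ((A - N)^-1 * (A - M)) ^ (b%:Z - k%:Z - 1).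
Proof.
move=> lt_kb; rewrite /geom_step /geom lt_kb ltnW // -!addrA -opprD.
by rewrite -[1]/(1%:Z) -PoszD addn1 !subzn // ltnW.
Qed.

(** * Shift matrices and the powers of [Sr] *)

Lemma shift_row_exp (R : nzRingType) (r k : nat) (T : 'M[R]_r.+1) :
    (forall i : 'I_r,
       'e_(lift ord_max i) *m T = 'e_(lift ord0 i) :> 'rV[R]_r.+1) ->
    (k <= r)%N ->
  'e_ord0 *m T ^+ k = 'e_(inord k) :> 'rV[R]_r.+1.
Proof.
move=> shiftT; elim: k => [|k IHk] lt_kr.
  by rewrite expr0 mulmx1; congr ('e_ _); apply: ord_inj; rewrite inordK.
rewrite exprSr -mulmxE mulmxA IHk ?(ltnW lt_kr) //.
have -> : inord k = lift ord_max (Ordinal lt_kr).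
  by apply: ord_inj; rewrite lift_max inordK // ltnS ltnW.
by rewrite shiftT; congr ('e_ _); apply: ord_inj; rewrite lift0 inordK.
Qed.

(** The vector ['e_ord0] is cyclic: every ['e_i] is ['e_ord0 *m T ^+ i], and [T ^+ m] commutes with
    [T ^+ i]. *)
Lemma shift_exp_scalar (R : comNzRingType) (r m : nat) (T : 'M[R]_r.+1) (c : R) :
    (forall i : 'I_r,
       'e_(lift ord_max i) *m T = 'e_(lift ord0 i) :> 'rV[R]_r.+1) ->
    'e_ord0 *m T ^+ m = c *: 'e_ord0 :> 'rV[R]_r.+1 ->
  T ^+ m = c%:M.
Proof.
move=> shiftT T0; apply/row_matrixP => i; rewrite !rowE -[i]inord_val.
rewrite -(shift_row_exp shiftT) ?leq_ord //.
rewrite -mulmxA mulmxE -exprD addnC exprD -mulmxE mulmxA T0 -scalemxAl.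
by rewrite mul_mx_scalar.
Qed.

Lemma Sr_row (r : nat) (i : 'I_r) :
  'e_(lift ord_max i) *m Sr r = 'e_(lift ord0 i) :> 'rV[rat]_r.+1.
Proof.
rewrite mulmxBr mulmx_sumr (bigD1 i) //= mul_delta_mx big1 ?addr0 => [|j ne_ji].
  by rewrite mul_delta_mx_0 ?subr0 // eq_sym neq_lift.
by rewrite mul_delta_mx_0 // (inj_eq lift_inj) eq_sym.
Qed.

Lemma Sr_row_max (r : nat) : 'e_ord_max *m Sr r = - 'e_ord0 :> 'rV[rat]_r.+1.
Proof.
rewrite mulmxBr mulmx_sumr mul_delta_mx big1 ?sub0r // => j _.
by rewrite mul_delta_mx_0 // neq_lift.
Qed.

Lemma Sr_exp (r : nat) : Sr r ^+ r.+1 = -1.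
Proof.
rewrite (@shift_exp_scalar _ r _ _ (-1)) ?rmorphN ?rmorph1 //.
  exact: Sr_row.
rewrite exprSr -mulmxE mulmxA (shift_row_exp (@Sr_row r)) // scaleN1r -Sr_row_max.
by congr ('e_ _ *m _); apply: ord_inj; rewrite inordK.
Qed.

(** The right factor is [1] on and above the diagonal and [-1] below. Consecutive rows differ by [2]
    in one entry, and the last row plus the first is twice the last unit row. *)
Lemma sub1Sr_mul (r : nat) : (1 - Sr r) * (1 - (Mr r + Nr r)) = 2%:R.
Proof.
have E (i j : 'I_r.+1) :
    (1 - (Mr r + Nr r)) i j = if (i <= j)%N then 1 else -1.
  by rewrite !mxE -val_eqE /=; case: (ltngtP i j).
move: (1 - (_ + _)) E => B E.
apply/row_matrixP => i; rewrite !rowE -mulmxE mulmxA mulmxBr mulmx1 mulmxBl.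
case: (unliftP ord_max i) => [k|] ->.
  rewrite Sr_row -!rowE; apply/rowP => j; rewrite !mxE !E ?mxE.
  rewrite -!(inj_eq (@ord_inj _)) lift_max ?lift0.
  by case: (ltngtP k j); rewrite /= ?subrr.
rewrite (Sr_row_max r) mulNmx -!rowE; apply/rowP => j; rewrite !mxE !E ?mxE.
rewrite -val_eqE /=.
by have := leq_ord j; case: (ltngtP r j).
Qed.

(** * The matrices [Nr] and [Mr], and the powers of [Xr] *)

Lemma Nr_row (r : nat) (i : 'I_r) :
  ('e_(lift ord0 i) - 'e_(lift ord_max i)) *m Nr r
  = 'e_(lift ord_max i) :> 'rV[rat]_r.+1.
Proof.
rewrite mulmxBl -!rowE; apply/rowP => j.
rewrite !mxE -!(inj_eq (@ord_inj _)) lift_max ?lift0.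
by case: (ltngtP i j).
Qed.

Lemma Mr_row (r : nat) (i : 'I_r) :
  ('e_(lift ord0 i) - 'e_(lift ord_max i)) *m Mr r
  = 'e_(lift ord0 i) :> 'rV[rat]_r.+1.
Proof.
rewrite mulmxBl -!rowE; apply/rowP => j.
rewrite !mxE -!(inj_eq (@ord_inj _)) lift_max ?lift0.
rewrite [(j <= i.+1)%N]leq_eqVlt ltnS; case: eqP => [->|_] /=; last first.
  by case: ifP; rewrite subrr.
by rewrite ltnn subr0 opprK.
Qed.

Lemma Nr_row_max (r : nat) : 'e_ord_max *m Nr r = - 'e_ord_max :> 'rV[rat]_r.+1.
Proof.
rewrite -rowE; apply/rowP => j; rewrite !mxE eqxx -(inj_eq (@ord_inj _)) /=.
by have := leq_ord j; case: ltngtP => // _ _; rewrite oppr0.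
Qed.

Lemma Mr_row_max (r : nat) : 'e_ord_max *m Mr r = const_mx 1 :> 'rV[rat]_r.+1.
Proof. by rewrite -!rowE; apply/rowP => j; rewrite !mxE leq_ord opprK. Qed.

Lemma Nr_unit (r : nat) : Nr r \in unitmx.
Proof.
(* [det_trig] expects zeros above the diagonal, hence the transpose. *)
rewrite -unitmx_tr unitmxE det_trig; last first.
  by apply/is_trig_mxP => i j lt_ij; rewrite mxE mxE leqNgt lt_ij.
by apply: rpred_prod => i _; rewrite mxE mxE leqnn.
Qed.

(** The same difference of unit rows goes to ['e_i] under [Nr] and to ['e_(i+1)] under [Mr], so the
    inverse of [Nr] need not be computed. *)
Lemma Xr_row (r : nat) (i : 'I_r) :
  'e_(lift ord_max i) *m Xr r = 'e_(lift ord0 i) :> 'rV[rat]_r.+1.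
Proof.
by rewrite -{1}Nr_row -mulmxA mulmxE /Xr mulVKr ?Nr_unit // Mr_row.
Qed.

Lemma Xr_row_max (r : nat) : 'e_ord_max *m Xr r = - const_mx 1 :> 'rV[rat]_r.+1.
Proof.
rewrite -['e_ord_max]opprK -Nr_row_max mulNmx -mulmxA mulmxE /Xr.
by rewrite mulVKr ?Nr_unit // Mr_row_max.
Qed.

(** [Xr r] is the companion matrix of [1 + x + ... + x^(r+1)], which divides [x^(r+2) - 1]. On
    ['e_ord0]: [r] shifts reach the last unit row, the next step gives minus the sum of all unit
    rows, and one more returns to ['e_ord0]. *)
Lemma Xr_exp (r : nat) : Xr r ^+ r.+2 = 1.
Proof.
move: (Xr r) (@Xr_row r) (Xr_row_max r) => T rowT rowT_max.
rewrite (shift_exp_scalar (c := 1) rowT) //.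
rewrite 2!exprSr -!mulmxE !mulmxA (shift_row_exp rowT) // scale1r.
have -> : inord r = ord_max :> 'I_r.+1 by apply: ord_inj; rewrite inordK.
have sum_e : const_mx 1 = \sum_(i < r.+1) 'e_i :> 'rV[rat]_r.+1.
  rewrite [LHS]row_sum_delta; apply: eq_bigr => i _.
  by rewrite mxE scale1r.
rewrite rowT_max mulNmx sum_e mulmx_suml.
rewrite (bigD1_ord ord_max) //= rowT_max sum_e (bigD1_ord ord0) //=.
rewrite (eq_bigr _ (fun i _ => rowT i)).
by rewrite opprD opprK addrK.
Qed.

Lemma Xr_unit (r : nat) : Xr r \in unitmx.
Proof. by rewrite -(@unitrX_pos _ _ r.+2) // Xr_exp unitr1. Qed.

(* [M_r - N_r = 1 + J] with [J] the all-ones matrix, and [J^2 = (r+1) J]. *)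
Lemma sub_Mr_Nr_unit (r : nat) : Mr r - Nr r \in unitmx.
Proof.
pose J : 'M[rat]_r.+1 := const_mx 1.
have -> : Mr r - Nr r = 1 + J.
  apply/matrixP => i j; rewrite !mxE -val_eqE /=.
  by case: (ltngtP i j).
have JJ : J * J = r.+1%:R *: J.
  apply/matrixP => i j; rewrite !mxE mulr1.
  under eq_bigr do rewrite !mxE mulr1.
  by rewrite sumr_const card_ord.
(* The scalar comes from [(1 + J) * J = (r + 2) J]. *)
suff /mulmx1_unit[] : (1 + J) *m (1 - r.+2%:R^-1 *: J) = 1%:M by [].
have mulJ : (1 + J) * J = r.+2%:R *: J.
  by rewrite mulrDl mul1r JJ -{1}[J]scale1r -scalerDl -mulrS.
rewrite mulmxE mulrBr mulr1 -scalerAr mulJ scalerA mulVf ?Num.Theory.pnatr_eq0 //.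
by rewrite scale1r addrK.
Qed.

(** * Blocks of the inverses of [HD] and [HS] *)

Lemma exprzSr (R : unitRingType) (x : R) (z : int) : x \is a GRing.unit ->
  x ^ z * x = x ^ (z + 1).
Proof. by move=> ux; rewrite exprzDr // expr1z. Qed.

Lemma tr_Mr (r : nat) : (Mr r)^T = - Nr r.
Proof. by rewrite /Mr linearN /= trmxK. Qed.

Lemma tr_HD (n r : nat) : (HD n r)^T = - HD n r.
Proof.
by rewrite /HD -[Nr r]opprK -tr_Mr tr_blockH // trmx0 oppr0.
Qed.

Lemma tr_HS (n r : nat) : (HS n r)^T = - HS n r.
Proof.
rewrite /HS -[X in blockH _ _ _ (- X)]trmx1 tr_blockH //.
by rewrite linearN linearD /= tr_Mr /Mr !opprD !opprK addrC.
Qed.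

Lemma blk_invmx_HD (r : nat) (a b : 'I_r.+1) : HD r.+1 r \in unitmx ->
  1 + Xr r \in unitmx /\
  blk (invmx (HD r.+1 r)) a b
  = - ((geom_step 0 (Mr r) (Nr r) b a
        + Xr r ^ (b%:Z - a%:Z - 1) * (1 + Xr r)^-1) * (Nr r)^-1).
Proof.
move=> uH; have uN : Nr r \is a GRing.unit := Nr_unit r.
have uX : Xr r \is a GRing.unit := Xr_unit r.
have uD : 0 - Nr r \in unitmx by rewrite sub0r unitrN.
have uMN := sub_Mr_Nr_unit r.
have XE : (0 - Nr r)^-1 * (0 - Mr r) = Xr r by rewrite !sub0r invrN mulrNN.
have uX1 : 1 - Xr r \is a GRing.unit by rewrite -XE; apply: unit_sub1X.
have ME : Mr r = Nr r * Xr r by rewrite /Xr mulVKr.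
have XnE : Xr r ^+ r.+1 = (Xr r)^-1.
  by apply: (mulIr uX); rewrite -exprSr Xr_exp mulVr.
have := unit_Fmx uD uMN uH; rewrite blk_invmx_blockH // /block_inv_entry.
rewrite /Fmx /Xmx XE XnE.
move: (Xr r) (Xr_exp r) XE uX uX1 ME XnE => X Xexp XE uX uX1 ME XnE.
have -> : (Mr r - Nr r * X^-1) * (1 - X)^-1 = - (Nr r * X^-1 * (1 + X)).
  apply: (canLR (mulrK uX1)).
  rewrite ME mulNr -!mulrA -mulrBr -mulrN; congr (_ * _).
  rewrite mulrA [X^-1 * _]mulrDr mulr1 mulVr // mulrBr mulr1 mulrDl mul1r mulVr //.
  by rewrite opprB [1 + X]addrC [X^-1 + 1]addrC addrKA.
(* [F] is invertible because [HD] is, and its other factors are units, so [1 + X] is a unit. *)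
rewrite [_ \in unitmx]unitrN unitrMr ?unitrMr ?unitrV // => u1X.
split=> //; rewrite sub0r !invrN !invrM ?unitrMr ?unitrV // invrK.
have com1X k : GRing.comm (1 + X)^-1 (X ^+ k).
  apply/commr_sym/commrV; apply: commrD; first exact: commr1.
  exact/commr_sym/commrX/commr_refl.
(* The natural exponent [r - a + b + 1] exceeds [b - a - 1] by [r + 2], a period of [X]. *)
have powE : X ^ (b%:Z - a%:Z - 1) = X ^+ (r - a) * (X * X ^+ b).
  have -> : b%:Z - a%:Z - 1 = (r - a + b.+1)%:Z - r.+2%:Z.
    by have := leq_ord a; lia.
  by rewrite exprzDr // -invr_expz -!exprnP Xexp invr1 mulr1 exprD exprS.
rewrite powE mulrN; congr (- (_ * _)).
rewrite mulrN !mulNr opprK; congr (_ + _).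
rewrite -!mulrA mulKr //; congr (_ * _).
by rewrite -exprS com1X exprS mulrA.
Qed.
Lemma Sr_unit (r : nat) : Sr r \in unitmx.
Proof. by rewrite -(@unitrX_pos _ _ r.+1) // Sr_exp unitrN1. Qed.

(** By [sub1Sr_mul], [A - N] has inverse [(1 - S) / 2]. As [A - M = (A - N) - 2], this gives
    [X = 1 - (1 - S) = S], and [S ^+ r.+2 = - S] turns [F] into [(1 - S) * (1 - S)^-1]. *)
Lemma HS_data (r : nat) (A := - (Mr r + Nr r)) :
  [/\ A - - 1 \in unitmx, 1 - - 1 \in (@unitmx rat r.+1),
      (A - - 1)^-1 = 2^-1 *: (1 - Sr r),
      (A - - 1)^-1 * (A - 1) = Sr r & Fmx r.+2 A 1 (- 1) = 1].
Proof.
have DE : A - - 1 = 1 - (Mr r + Nr r) by rewrite opprK addrC.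
have VD : (2^-1 *: (1 - Sr r)) * (A - - 1) = 1.
  by rewrite DE -scalerAl sub1Sr_mul -scaler_nat scalerA mulVf // scale1r.
have [] := mulmx1_unit VD; rewrite unitmxZ // => u1S uD.
have DV : (A - - 1)^-1 = 2^-1 *: (1 - Sr r).
  by apply: (mulIr uD); rewrite VD mulVr.
have XE : (A - - 1)^-1 * (A - 1) = Sr r.
  have -> : A - 1 = (A - - 1) - 2%:R by rewrite opprK mulr2n opprD addrA addrK.
  rewrite mulrBr mulVr // DV -scalerAl mulr_natr -scaler_nat scalerA mulVf //.
  by rewrite scale1r opprB addrC subrK.
split=> //; first by rewrite opprK -mulr2n -scaler_nat unitmxZ ?unitmx1.
rewrite /Fmx /Xmx XE exprSr Sr_exp !mulN1r opprK divrr //.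
Qed.

(** As [F = 1] is a unit, the explicit right inverse exists, which proves [HS] invertible. *)
Lemma HS_unit (r : nat) : HS r.+2 r \in unitmx.
Proof.
have [uD uMN _ _ F1] := HS_data r.
have uF : Fmx r.+2 (- (Mr r + Nr r)) 1 (- 1) \in unitmx by rewrite F1 unitr1.
by have [] := mulmx1_unit (mul_blockH_inv uD uMN uF).
Qed.

Lemma blk_invmx_HS (r : nat) (a b : 'I_r.+2) :
  blk (invmx (HS r.+2 r)) a b
  = 2^-1 *: ((geom_step (- (Mr r + Nr r)) 1 (- 1) b a - Sr r ^ (b%:Z - a%:Z))
             * (1 - Sr r)).
Proof.
have [uD uMN DV XE F1] := HS_data r.
rewrite blk_invmx_blockH ?HS_unit // /block_inv_entry.
move: F1; rewrite /Fmx /Xmx XE DV => ->; rewrite -scalerAr.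
rewrite invr1 mulr1 mulrN1 mulNr; congr (_ *: ((_ - _) * _)).
(* Lowering the exponent by [r + 1] costs a sign, since [S ^+ r.+1 = -1]. *)
have -> : b%:Z - a%:Z = (r.+1 - a + b)%:Z - r.+1%:Z.
  by have := leq_ord a; lia.
rewrite exprzDr ?Sr_unit // -invr_expz -!exprnP Sr_exp invrN1 mulrN1.
by rewrite exprD.
Qed.

Theorem proposition3p9 (n r : nat) (n_gt0 : (0 < n)%N) :
  [/\ (forall A0 M0 : 'M[int]_r.+1, A0^T = - A0 ->
        let A := ratmx A0 in
        let M := ratmx M0 in
        let N := - M^T in
        let H := blockH n A M N in
        let X := Xmx A M N in
        let F := Fmx n A M N in
        A - N \in unitmx -> M - N \in unitmx -> H \in unitmx ->
        [/\ 1 - X \in unitmx, F \in unitmx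
          & forall a b : 'I_n,
            [/\ a = b ->
                  blk (invmx H) a b
                  = (1 - X ^+ (n - a.+1) * F^-1 * N * X ^+ a) * (A - N)^-1,
                (b < a)%N ->
                  blk (invmx H) a b
                  = (- (X ^+ (n - a.+1) * F^-1 * N * X ^+ b)) * (A - N)^-1
              & (a < b)%N ->
                  blk (invmx H) a b = - (blk (invmx H) b a)^T]]),
      (n = r.+1 -> HD n r \in unitmx ->
        [/\ Nr r \in unitmx, Xr r \in unitmx, 1 + Xr r \in unitmx
          & forall a b : 'I_n,
            [/\ a = b ->
                  blk (invmx (HD n r)) a b
                  = - ((1 + Xr r ^+ n * (1 + Xr r)^-1) * (Nr r)^-1),
                (b < a)%N ->
                  blk (invmx (HD n r)) a b
                  = - (Xr r ^ (b%:Z - a%:Z - 1) * (1 + Xr r)^-1 * (Nr r)^-1)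
              & (a < b)%N ->
                  blk (invmx (HD n r)) a b
                  = - (Xr r ^ (b%:Z - a%:Z + 1) * (1 + Xr r)^-1 * (Nr r)^-1)
                  /\ blk (invmx (HD n r)) a b
                     = - (blk (invmx (HD n r)) b a)^T]])
    & (n = r.+2 ->
        [/\ HS n r \in unitmx, Sr r \in unitmx
          & forall a b : 'I_n,
            [/\ a = b -> blk (invmx (HS n r)) a b = 0,
                (b < a)%N ->
                  blk (invmx (HS n r)) a b
                  = 2^-1 *: (Sr r ^ (b%:Z - a%:Z + 1) - Sr r ^ (b%:Z - a%:Z))
              & (a < b)%N ->
                  blk (invmx (HS n r)) a b
                  = 2^-1 *: (Sr r ^ (b%:Z - a%:Z) - Sr r ^ (b%:Z - a%:Z - 1))
                  /\ blk (invmx (HS n r)) a b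
                     = - (blk (invmx (HS n r)) b a)^T]])].

Proof.
case: n n_gt0 => // n _; split.
- move=> A0 M0 skA0 A M N H X F uD uMN uH.
  have skH : H^T = - H.
    by apply: tr_blockH; rewrite /A /ratmx map_trmx skA0 map_mxN.
  split; [exact: unit_sub1X | exact: unit_Fmx | move=> a b].
  split=> [<-|lt_ba|lt_ab]; last exact: tr_blk_invmx.
  + by rewrite blk_invmx_blockH // /block_inv_entry geom_step_eq subSS.
  + by rewrite blk_invmx_blockH // /block_inv_entry geom_step_gt // sub0r subSS.
- case=> -> uH; have [u1X _] := blk_invmx_HD ord0 ord0 uH.
  split=> //; [exact: Nr_unit | exact: Xr_unit | move=> a b].
  have [_ E] := blk_invmx_HD a b uH.
  have uX : Xr r \is a GRing.unit := Xr_unit r.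
  split=> [ab|lt_ba|lt_ab]; rewrite E.
  (* On the diagonal the power is [X^-1], which equals [X ^+ r.+1] by periodicity. *)
  + rewrite ab geom_step_eq subrr sub0r exprN1; congr (- ((_ + _ * _) * _)).
    by apply: (mulIr uX); rewrite -exprSr Xr_exp mulVr.
  + by rewrite geom_step_gt // add0r.
  + rewrite -E; split; last exact/tr_blk_invmx/tr_HD.
    (* With [d = b - a], multiplying by [1 + X] leaves [(X^d - X^(d-1)) (1 + X) + X^(d-1) =
       X^(d+1)]. *)
    rewrite E geom_step_lt //; congr (- (_ * _)); apply: (mulIr u1X).
    rewrite mulrDl !mulrBl -!mulrA ?mulVr //.
    rewrite !sub0r invrN mulrNN -/(Xr r) !mulr1 !mulrDr !mulr1 !exprzSr // subrK.
    by rewrite [X in X - _]addrC [X in _ - X]addrC addrKA subrK.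
case=> ->; split; [exact: HS_unit | exact: Sr_unit | move=> a b].
have uS : Sr r \is a GRing.unit := Sr_unit r.
have [_ _ _ XE _] := HS_data r.
split=> [ab|lt_ba|lt_ab].
- by rewrite blk_invmx_HS ab geom_step_eq subrr expr0z subrr mul0r scaler0.
- rewrite blk_invmx_HS geom_step_gt // sub0r mulNr mulrBr mulr1 opprB.
  by rewrite exprzSr.
split; last exact/tr_blk_invmx/tr_HS.
rewrite blk_invmx_HS geom_step_lt // XE.
(* The two terms [S^(b-a)] cancel, leaving [- S^(b-a-1) (1 - S)]. *)
rewrite addrAC subrr sub0r mulNr mulrBr mulr1 opprB; congr (_ *: (_ - _)).
by rewrite exprzSr // subrK.
Qed.
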